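(* Let $u_0\in\mathrm{BV}_{\mathrm{loc}}([0,+\infty))$ be right-continuous and nonnegative, and suppose there exists $\alpha>0$ with $u_0(t)\ge\alpha$ for all $t\in[0,\alpha)$. Let $\ell:[0,+\infty)\to[0,+\infty)$ be the (unique) solution in $\mathrm{BV}_{\mathrm{loc}}([0,+\infty))$ of $$\ell(t)=u_0(t)+\bigl|\{\,s\in[0,t]:\ \ell(t-s)>s\,\}\bigr|\qquad\forall t\in[0,+\infty).$$ Then the function $$v(\tau,\xi):=u_0(\xi)+\bigl|\{\,s\in[0,\tau]:\ \ell(s)+s>\xi\,\}\bigr|,\qquad \tau\ge0,\ \xi\ge\tau,$$ is (restricted to $\{\tau>0,\ \xi>\tau\}$) the unique integral solution with initial datum $u_0$, and $v(\tau,\tau)=\ell(\tau)$ for all $\tau\in[0,+\infty)$. Moreover: (i) for any $\xi\in[0,+\infty)$ the function $v(\cdot,\xi)$ is $1$-Lipschitz (on $[0,\xi]$); (ii) $v(\tau,\cdot)\in\mathrm{BV}_{\mathrm{loc}}([\tau,+\infty))$ for any $\tau>0$; (iii) if $u_{0,1},u_{0,2}$ are two initial data both satisfying the assumptions made on $u_0$ (right-continuous, nonnegative, in $\mathrm{BV}_{\mathrm{loc}}([0,+\infty))$, and each bounded below by some $\alpha>0$ on $[0,\alpha)$), and $v_1,v_2$ are the functions defined as $v$ with $u_0$ replaced by $u_{0,1}$, $u_{0,2}$ (and $\ell$ by the corresponding solutions), then $u_{0,1}\le u_{0,2}$ implies $v_1\le v_2$; (iv) if there exists $C>0$ such that for all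 $\xi\in[0,+\infty)$ $$\frac{u_0(\xi+h)-u_0(\xi)}{h}\le C,\qquad h>0,$$ then for all $(\tau,\xi)$ with $\tau\ge0$, $\xi\ge\tau$, $$\frac{v(\tau,\xi+h)-v(\tau,\xi)}{h}\le C,\qquad h>0;$$ (v) if $u_0\in L^1((0,+\infty))$ is bounded then $v(\tau,\cdot)\in L^1((\tau,+\infty))$ and $$\int_\tau^{+\infty}v(\tau,\xi)\,d\xi=\int_0^{+\infty}u_0(\xi)\,d\xi\qquad\forall\tau\in[0,+\infty).$$
   Context: $|\cdot|$ denotes one-dimensional Lebesgue measure and $1_A$ the characteristic function of $A$. $\mathrm{BV}_{\mathrm{loc}}([a,+\infty))$ is the class of functions on $[a,+\infty)$ having finite pointwise variation on $[a,b]$ for every $b>a$. All functions are Lebesgue measurable. Integral solution (with initial datum $u_0$; it is the notion of solution for the problem $u_t=u_x+1_{(0,u(t,0))}(x)$, $u(0,\cdot)=u_0$, in the coordinates $\tau=t$, $\xi=t+x$): a locally bounded function $w:\{(\tau,\xi):\tau>0,\ \xi>\tau\}\to[0,+\infty)$, defined everywhere, such that for any $\tau>0$ the limit $w(\tau,\tau):=\lim_{\xi\to\tau^+}w(\tau,\xi)$ exists in $[0,+\infty)$, and for every $(\tau,\xi)$ with $\tau>0$, $\xi>\tau$, $$w(\tau,\xi)=u_0(\xi)+\int_0^\tau 1_{(s,\,w(s,s)+s)}(\xi)\,ds.$$ *)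

(* Defs.v *)
From HB Require Import structures.
From mathcomp Require Import all_boot all_order all_algebra.
From mathcomp Require Import all_classical all_reals all_analysis.
From mathcomp Require Import measurable_realfun.

Set Implicit Arguments.
Unset Strict Implicit.
Unset Printing Implicit Defensive.

Import Order.TTheory GRing.Theory Num.Theory.
Import numFieldNormedType.Exports.

Local Open Scope classical_set_scope.
Local Open Scope ring_scope.

(* A function on a half-line [a, +oo[ (or on a subset of the plane) is given by
   a total function, of which only the values on that domain are used. *)

(* [lebesgue_measure] is a measure on the Borel sets, but as a set function it
   is the Lebesgue outer measure: its value is right on all Lebesgue measurable
   sets. The sets measured below have finite measure, so [fine] loses nothing.
   Likewise the integral of the indicator function of a Lebesgue measurable set
   with respect to [lebesgue_measure] is the Lebesgue measure of the set. *)
Definition length_of (R : realType) (A : set R) : R :=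
  fine (lebesgue_measure A).

Definition BVloc (R : realType) (a : R) (f : R -> R) : Prop :=
  forall b, a < b -> bounded_variation a b f.

(* Measurability with respect to the completion of [mu]: Lebesgue (and not only
   Borel) measurability when [mu] is [lebesgue_measure]
   or its product with itself. *)
Definition completed_measurable_fun (d : measure_display)
    (T : measurableType d) (R : realType) (mu : set T -> \bar R)
    (D : set T) (f : T -> R) : Prop :=
  forall Y : set R, measurable Y ->
    completed_algebra_gen mu (D `&` f @^-1` Y).

Definition admissible_datum (R : realType) (u0 : R -> R) : Prop :=
  [/\ BVloc 0 u0,
      forall x : R, 0 <= x -> u0 y @[y --> x^'+] --> u0 x,
      forall x : R, 0 <= x -> 0 <= u0 x &
      exists2 alpha : R, 0 < alpha &
        forall t : R, 0 <= t < alpha -> alpha <= u0 t].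

Definition delay_solution (R : realType) (u0 l : R -> R) : Prop :=
  [/\ BVloc 0 l,
      forall t : R, 0 <= t -> 0 <= l t &
      forall t : R, 0 <= t ->
        l t = u0 t + length_of [set s | 0 <= s <= t /\ s < l (t - s)]].

Definition vsol (R : realType) (u0 l : R -> R) (tau xi : R) : R :=
  u0 xi + length_of [set s | 0 <= s <= tau /\ xi < l s + s].

Definition open_domain (R : realType) : set (R * R) :=
  [set p | 0 < p.1 /\ p.1 < p.2].

Definition trace (R : realType) (w : R -> R -> R) (tau : R) : R :=
  lim (w tau xi @[xi --> tau^'+]).

(* The integral is taken over ]0, tau[ because the trace is only defined at
   positive times. *)
Definition integral_solution (R : realType) (u0 : R -> R) (w : R -> R -> R)
    : Prop :=
  [/\ completed_measurable_fun (lebesgue_measure \x lebesgue_measure)%E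
        (@open_domain R) (fun p => w p.1 p.2),
      [locally [bounded w p.1 p.2 | p in @open_domain R]],
      forall tau xi : R, 0 < tau -> tau < xi -> 0 <= w tau xi,
      forall tau : R, 0 < tau ->
        cvg (w tau xi @[xi --> tau^'+]) /\ 0 <= trace w tau &
      forall tau xi : R, 0 < tau -> tau < xi ->
        let integrand := fun s : R => \1_(`]s, trace w s + s[) xi : R in
        completed_measurable_fun lebesgue_measure `]0, tau[ integrand /\
        w tau xi =
          u0 xi + (\int[lebesgue_measure]_(s in `]0, tau[) integrand s)%R].

(* Main.v *)
Require Import Defs.
From HB Require Import structures.
From mathcomp Require Import all_boot all_order all_algebra.
From mathcomp Require Import all_classical all_reals all_analysis.
From mathcomp Require Import measurable_realfun lra.

Set Implicit Arguments.
Unset Strict Implicit.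
Unset Printing Implicit Defensive.

Import Order.TTheory GRing.Theory Num.Theory.
Import numFieldNormedType.Exports.

Local Open Scope classical_set_scope.
Local Open Scope ring_scope.

(** Everything is read off the source term
      [source_time l tau xi = |{s in (0, tau) : l s + s > xi}|],
    for which [v tau xi = u0 xi + source_time l tau xi].

    Substituting [s := t - s] in the delay equation turns it into
    [l t = u0 t + source_time l t t], that is [v t t = l t]
    ([delay_solutionE]). As [xi] decreases to [tau] the sets
    [{l s + s > xi}] increase to [{l s + s > tau}], so continuity from below of
    the measure and right continuity of [u0] identify the trace of [v] at [tau]
    with [l tau] ([vsol_at_right]); hence [v] is an integral solution.

    For uniqueness, the same limit shows that the trace [m] of an arbitrary
    integral solution solves [m t = u0 t + source_time m t t] for [t > 0], and
    the question becomes uniqueness for this equation. The equation is a delay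
    equation in disguise: if [alpha <= l], then every [s] in
    [(t - alpha, t)] contributes to [source_time l t t] whatever the exact value
    of [l s], so [l t] depends only on [l] restricted to [(0, t - alpha]].
    The lower bound [alpha <= l] is itself propagated from [(0, alpha)], where
    [u0] provides it, by steps of length [alpha] ([delay_ge]). Advancing by
    steps of length [alpha] again gives a comparison principle
    ([delay_comparison]), which yields uniqueness ([delay_unique]) and
    the monotonicity (iii) ([vsol_le]).

    [source_time l tau xi] is 1-Lipschitz and nondecreasing in [tau] and
    nonincreasing in [xi]; this gives (i), (ii) and (iv).

    For (v), Tonelli's theorem on
    [{(s, xi) : 0 < s < tau, s < xi < l s + s}], cut along [xi = tau], reads
      [int_0^tau l = int_0^tau source_time l xi xi dxi
                     + int_tau^oo source_time l tau xi dxi]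
    ([tonelli_source]). By the delay equation the left-hand side is
    [int_0^tau u0 + int_0^tau source_time l xi xi dxi], so the source term has
    brought into [(tau, +oo)] exactly the mass of [u0] on [(0, tau)].

    Functions of locally bounded variation are Borel, being locally differences
    of nondecreasing functions, so all sets attached to [l] are Borel. For the
    trace of an unknown integral solution only Lebesgue measurability is
    available, so the estimates on [source_time] are proved for
    arbitrary sets, by monotonicity and subadditivity of the outer measure. *)

(** * Lengths of arbitrary bounded sets *)

Section length.
Context {R : realType}.
Implicit Types (A B : set R) (a b : R).

(** [lebesgue_measure] is defined on all sets as the outer measure, so
    monotonicity and subadditivity hold without measurability. *)
Lemma lebesgue_measure_le A B : A `<=` B ->
  (lebesgue_measure A <= lebesgue_measure B :> \bar R)%E.
Proof. by move=> AB; apply: le_outer_measure. Qed.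

Lemma lebesgue_measureU2 A B :
  (lebesgue_measure (A `|` B) <=
   lebesgue_measure A + lebesgue_measure B :> \bar R)%E.
Proof. by apply: outer_measureU2. Qed.

Lemma lebesgue_measure_itvoo a b : a <= b ->
  lebesgue_measure (`]a, b[%classic : set R) = (b - a)%:E.
Proof.
move=> ab; rewrite lebesgue_measure_itv /= lte_fin.
by case: ltgtP ab => // ->; rewrite subrr.
Qed.

Lemma lebesgue_measure_fin a b A :
  A `<=` `]a, b[ -> lebesgue_measure A \is a fin_num.
Proof.
move=> Aab; rewrite ge0_fin_numE// (le_lt_trans (lebesgue_measure_le Aab))//.
by rewrite lebesgue_measure_itv; case: ifP => _; rewrite ?ltry// -EFinB ltry.
Qed.

Lemma length_of_ge0 A : 0 <= length_of A.
Proof. by rewrite /length_of fine_ge0. Qed.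

Lemma length_of_le a b A B :
  A `<=` B -> B `<=` `]a, b[ -> length_of A <= length_of B.
Proof.
move=> AB Bab; apply: fine_le; last exact: lebesgue_measure_le.
  by apply: (@lebesgue_measure_fin a b); apply: subset_trans Bab.
exact: lebesgue_measure_fin Bab.
Qed.

Lemma length_ofU2 a b A B : A `<=` `]a, b[ -> B `<=` `]a, b[ ->
  length_of (A `|` B) <= length_of A + length_of B.
Proof.
move=> Aab Bab; have fA := lebesgue_measure_fin Aab.
have fB := lebesgue_measure_fin Bab.
rewrite /length_of -fineD//; apply: fine_le; last exact: lebesgue_measureU2.
  by apply: (@lebesgue_measure_fin a b) => x [/Aab|/Bab].
by rewrite fin_numD fA.
Qed.

Lemma length_of_itvoo a b : a <= b -> length_of `]a, b[%classic = b - a.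
Proof. by move=> ab; rewrite /length_of lebesgue_measure_itvoo. Qed.

Lemma length_of_set1 a : length_of [set a] = 0.
Proof. by rewrite /length_of lebesgue_measure_set1. Qed.

(** The two sets differ by at most the points [0] and [t]. *)
Lemma length_of_itvcc_itvoo t (P : set R) :
  length_of [set s | 0 <= s <= t /\ P s] =
  length_of [set s | 0 < s < t /\ P s].
Proof.
apply/eqP; rewrite eq_le; apply/andP; split; last first.
  apply: (@length_of_le (-1) (t + 1)) => s /= [st Ps]; last first.
    by rewrite in_itv/=; lra.
  by split => //; lra.
set A := [set s | 0 < s < t /\ P s].
have A_bnd : A `<=` `]-1 - `|t|, t + 1 + `|t|[.
  move=> s [/= st _]; rewrite in_itv/=; have := normr_ge0 t; lra.
have [tlo thi] : - `|t| <= t /\ t <= `|t|.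
  by split; rewrite ?ler_norm// lerNl -normrN ler_norm.
have pt_bnd x : (x = 0) \/ (x = t) -> [set x] `<=` `]-1 - `|t|, t + 1 + `|t|[.
  by move=> xE y ->; rewrite /= in_itv/=; case: xE => ->; lra.
have b0 := pt_bnd 0 (or_introl erefl); have bt := pt_bnd t (or_intror erefl).
have : length_of (A `|` ([set 0] `|` [set t])) <= length_of A.
  apply: le_trans (length_ofU2 A_bnd _) _; first by rewrite subUset.
  have := length_ofU2 b0 bt; rewrite !length_of_set1; lra.
apply: le_trans; apply: (@length_of_le (-1 - `|t|) (t + 1 + `|t|)).
  move=> s /= [/andP[s0 st] Ps]; move: s0 st.
  rewrite le_eqVlt => /predU1P[<- _|s0]; first by right; left.
  rewrite le_eqVlt => /predU1P[->|st]; first by right; right.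
  by left; rewrite /A/= s0 st.
by rewrite subUset; split => //; rewrite subUset.
Qed.

End length.

(** * The source term *)

(** The endpoints of the time interval are left out because the trace of an
    integral solution is a solution of the delay equation at positive times
    only. *)
Definition source_set (R : realType) (l : R -> R) (tau xi : R) : set R :=
  [set s | 0 < s < tau /\ xi < l s + s].

Definition source_time (R : realType) (l : R -> R) (tau xi : R) : R :=
  length_of (source_set l tau xi).

Section source_time.
Context {R : realType}.
Implicit Types (l : R -> R) (tau xi : R).

Lemma vsolE u l tau xi : vsol u l tau xi = u xi + source_time l tau xi.
Proof. by rewrite /vsol length_of_itvcc_itvoo. Qed.

Lemma source_time_ge0 l tau xi : 0 <= source_time l tau xi.
Proof. exact: length_of_ge0. Qed.

Lemma source_set_sub l tau xi : source_set l tau xi `<=` `]0, tau[.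
Proof. by move=> s [/= st _]; rewrite in_itv. Qed.

Lemma source_time_le l1 l2 tau xi1 xi2 :
  (forall s, 0 < s < tau -> xi1 < l1 s + s -> xi2 < l2 s + s) ->
  source_time l1 tau xi1 <= source_time l2 tau xi2.
Proof.
move=> h; apply: (@length_of_le _ 0 tau); last exact: source_set_sub.
by move=> s [st ls]; split => //; exact: h.
Qed.

Lemma source_time_nonincreasing l tau xi1 xi2 : xi1 <= xi2 ->
  source_time l tau xi2 <= source_time l tau xi1.
Proof. by move=> xi12; apply: source_time_le => s _; lra. Qed.

Lemma source_time_nondecreasing l tau1 tau2 xi : tau1 <= tau2 ->
  source_time l tau1 xi <= source_time l tau2 xi.
Proof.
move=> t12; apply: (@length_of_le _ 0 tau2); last exact: source_set_sub.
by move=> s /= [st ls]; split => //; lra.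
Qed.

Lemma source_time_le_add l tau1 tau2 xi : 0 <= tau1 -> tau1 <= tau2 ->
  source_time l tau2 xi <= source_time l tau1 xi + (tau2 - tau1).
Proof.
move=> t1 t12; set A := source_set l tau1 xi.
have Abnd : A `<=` `]-1, tau2 + 1[.
  by move=> s [/= ? _]; rewrite in_itv/=; lra.
have Bbnd : `]tau1, tau2[%classic `<=` `]-1, tau2 + 1[.
  by move=> s; rewrite /= !in_itv/=; lra.
have Cbnd : [set tau1] `<=` `]-1, tau2 + 1[.
  by move=> s ->; rewrite /= !in_itv/=; lra.
have BCbnd : `]tau1, tau2[%classic `|` [set tau1] `<=` `]-1, tau2 + 1[.
  by rewrite subUset.
have h1 := length_ofU2 Abnd BCbnd.
have h2 := length_ofU2 Bbnd Cbnd.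
rewrite (length_of_itvoo t12) length_of_set1 in h2.
have h3 : source_time l tau2 xi <=
    length_of (A `|` (`]tau1, tau2[%classic `|` [set tau1])).
  apply: (@length_of_le _ (-1) (tau2 + 1)); last by rewrite subUset.
  move=> s /= [/andP[s0 st] ls]; have [st1|st1|->] := ltgtP s tau1.
  - by left; rewrite /A /source_set /= s0 st1.
  - by right; left; rewrite /= in_itv/= st1.
  - by right; right.
rewrite -/(source_time l tau1 xi) in h1; lra.
Qed.

Lemma source_time_le_tau l tau xi : 0 <= tau -> source_time l tau xi <= tau.
Proof.
move=> t0; rewrite -[leRHS]subr0 -length_of_itvoo//.
by apply: (@length_of_le _ 0 tau) => //; exact: source_set_sub.
Qed.

(** How lower bounds on [l] are turned into lower bounds on the source. *)
Lemma source_time_ge l tau xi a b : 0 <= a -> a <= b -> b <= tau ->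
  (forall s, a < s < b -> xi < l s + s) -> b - a <= source_time l tau xi.
Proof.
move=> a0 ab bt h; rewrite -length_of_itvoo//.
apply: (@length_of_le _ 0 tau); last exact: source_set_sub.
by move=> s /=; rewrite in_itv/= => sab; split; [lra|exact: h].
Qed.

End source_time.

(** * The delay equation *)

Section delay_equation.
Context {R : realType}.
Implicit Types (u l : R -> R) (alpha : R).

(** The bound is propagated by steps of length [alpha]. Suppose it holds on
    [(0, T)] and let [T <= t < T + alpha]. Counting only the times before [T],
    the source at [r] in [[T, t]] is at least [T - (r - alpha)], so
    [T + alpha <= l r + r]. Since this exceeds [t], all of [(t - alpha, t)] is
    now counted at [t]: the times after [T] by this estimate, the
    times before [T] by the induction hypothesis. *)
Lemma delay_ge u l alpha : 0 < alpha ->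
  (forall t, 0 < t -> 0 <= u t) -> (forall t, 0 < t < alpha -> alpha <= u t) ->
  (forall t, 0 < t -> l t = u t + source_time l t t) ->
  forall t, 0 < t -> alpha <= l t.
Proof.
move=> a0 u0 ua eq.
suff P n : forall t, 0 < t < n%:R * alpha -> alpha <= l t.
  move=> t t0.
  apply: (P (Num.bound (t / alpha))); rewrite t0 /=.
  by rewrite -ltr_pdivrMr// archi_boundP// divr_ge0// ltW.
elim: n => [|n IH] t; first by rewrite mul0r => /andP[]; lra.
rewrite -natr1 mulrDl mul1r; set T := n%:R * alpha in IH *.
have T0 : 0 <= T by rewrite mulr_ge0// ltW.
move=> tT; have [ta|ta] := ltP t alpha.
  have := ua t ltac:(lra); have := source_time_ge0 l t t.
  by rewrite (eq t); lra.
have [tT'|Tt] := ltP t T; first by apply: IH; lra.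
(* For [r < alpha] the interval [(r - alpha, T)] would reach negative times;
   but then [T = 0] and the bound on [u] suffices. *)
have T1 r : T <= r -> 0 < r -> r < T + alpha -> T + alpha <= l r + r.
  move=> Tr r0 rT; have [ra|ra] := ltP r alpha.
    have := source_time_ge0 l r r.
    have nT : T = 0.
      move: Tr; rewrite /T; case: (n) => [|m]; first by rewrite mul0r.
      rewrite -natr1 mulrDl mul1r.
      by have := mulr_ge0 (ler0n R m) (ltW a0); lra.
    by have := ua r ltac:(lra); rewrite (eq r) // nT; lra.
  have := @source_time_ge _ l r r (r - alpha) T.
  have := u0 r r0; rewrite (eq r)// => ur h.
  suff : T - (r - alpha) <= source_time l r r by lra.
  apply: h; try lra.
  by move=> s sr; have := IH s ltac:(lra); lra.
have := u0 t ltac:(lra); rewrite (eq t); last lra.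
move=> ut.
have h := @source_time_ge _ l t t (t - alpha) t.
suff : t - (t - alpha) <= source_time l t t by lra.
apply: h; try lra.
move=> s st; have [sT|Ts] := ltP s T; first by have := IH s ltac:(lra); lra.
by have := T1 s ltac:(lra) ltac:(lra) ltac:(lra); lra.
Qed.

(** A time [s] in [(t - alpha, t)] is counted for [l2] at [t] because
    [t < alpha + s <= l2 s + s]; at earlier times the comparison is already
    known. Hence the comparison advances by steps of length [alpha]. *)
Lemma delay_comparison u1 u2 l1 l2 alpha : 0 < alpha ->
  (forall t, 0 < t -> alpha <= l2 t) ->
  (forall t, 0 < t -> u1 t <= u2 t) ->
  (forall t, 0 < t -> l1 t = u1 t + source_time l1 t t) ->
  (forall t, 0 < t -> l2 t = u2 t + source_time l2 t t) ->
  forall t, 0 < t -> l1 t <= l2 t.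
Proof.
move=> a0 l2a u12 eq1 eq2.
suff P n : forall t, 0 < t < n%:R * alpha -> l1 t <= l2 t.
  move=> t t0; apply: (P (Num.bound (t / alpha))); rewrite t0 /=.
  by rewrite -ltr_pdivrMr// archi_boundP// divr_ge0// ltW.
elim: n => [|n IH] t; first by rewrite mul0r => /andP[]; lra.
rewrite -natr1 mulrDl mul1r; set T := n%:R * alpha in IH * => tT.
have t0 : 0 < t by lra.
rewrite eq1// eq2// lerD ?u12//; apply: source_time_le => s st ls.
have [sT|Ts] := ltP s T; first by have := IH s ltac:(lra); lra.
by have := l2a s ltac:(lra); lra.
Qed.

Lemma delay_unique u l1 l2 alpha : 0 < alpha ->
  (forall t, 0 < t -> 0 <= u t) -> (forall t, 0 < t < alpha -> alpha <= u t) ->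
  (forall t, 0 < t -> l1 t = u t + source_time l1 t t) ->
  (forall t, 0 < t -> l2 t = u t + source_time l2 t t) ->
  forall t, 0 < t -> l1 t = l2 t.
Proof.
move=> a0 u0 ua eq1 eq2 t t0; apply/le_anti/andP; split.
  exact: (delay_comparison a0 (delay_ge a0 u0 ua eq2) _ eq1 eq2).
exact: (delay_comparison a0 (delay_ge a0 u0 ua eq1) _ eq2 eq1).
Qed.

End delay_equation.

(** * Functions of locally bounded variation *)

Section bounded_variation.
Context {R : realType}.
Implicit Types (f : R -> R) (a b : R).

(** Composing with the projection onto [[a, b]] gives a function that is
    nondecreasing on the whole line. *)
Lemma nondecreasing_in_measurable a b f :
  {in `[a, b] &, nondecreasing_fun f} -> measurable_fun `[a, b] f.
Proof.
have [ab ndf|ba _] := leP a b; last first.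
  by rewrite set_itv_ge ?bnd_simp -?ltNge//; exact: measurable_fun_set0.
pose c x := Num.max a (Num.min b x).
have cab x : c x \in `[a, b].
  by rewrite in_itv/= /c le_max lexx ge_max ab ge_min lexx.
apply: (eq_measurable_fun (f \o c)).
  move=> x; rewrite inE/= in_itv/= => /andP[ax xb] /=; congr f.
  by rewrite /c (min_idPr xb) (max_idPr ax).
apply: nondecreasing_measurable => // x y xy.
by apply: ndf; rewrite ?cab// /c le_max2// le_min2.
Qed.

Lemma bounded_variation_measurable a b f :
  bounded_variation a b f -> measurable_fun `[a, b] f.
Proof.
move=> bv.
apply: (eq_measurable_fun ((fine \o pos_tv a f) \- (fine \o neg_tv a f))).
  move=> x; rewrite inE => xab.
  by rewrite -(bounded_variation_pos_neg_tvE bv).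
apply: measurable_funB; apply: nondecreasing_in_measurable.
  exact: (fine_neg_tv_nondecreasing (bounded_variationN bv)).
exact: fine_neg_tv_nondecreasing.
Qed.

Lemma BVloc_measurable a f : BVloc a f -> measurable_fun `[a, +oo[ f.
Proof.
move=> bv; have -> : `[a, +oo[%classic = \bigcup_n `[a, a + n.+1%:R]%classic.
  apply/seteqP; split => x /=; last first.
    by move=> [n _] /=; rewrite !in_itv/=; lra.
  rewrite in_itv/= andbT => ax; exists (Num.bound (x - a)) => //=.
  rewrite in_itv/= ax/= -lerBlDl -natr1.
  by have := archi_boundP (x := x - a); rewrite subr_ge0 => /(_ ax); lra.
apply/measurable_fun_bigcup => // n; apply: bounded_variation_measurable.
by apply: bv; rewrite ltrDl ltr0n.
Qed.

Lemma BVloc_bounded a b f : BVloc a f ->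
  exists2 M, 0 < M & forall x, a <= x <= b -> `|f x| <= M.
Proof.
move=> bv; pose b1 := Num.max b a + 1.
have [bb1 ab1] : b < b1 /\ a < b1.
  by rewrite /b1; split; rewrite ltr_pwDr// le_max lexx ?orbT.
have [M hM] := bv b1 ab1.
exists (`|f a| + `|M| + 1) => [|x /andP[ax xb]].
  by have := normr_ge0 (f a); have := normr_ge0 M; lra.
have [<-|xa] := eqVneq a x; first by have := normr_ge0 M; lra.
have : `|f x - f a| <= M.
  apply: le_trans (_ : variation a b1 f [:: x; b1] <= M).
    rewrite /variation /= big_nat_recl//= lerDl sumr_ge0//.
  apply: hM; exists [:: x; b1] => //; split => //=.
  by rewrite lt_neqAle xa ax /= andbT; lra.
have := ler_norm M; have := ler_normD (f x - f a) (f a); rewrite subrK; lra.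
Qed.

End bounded_variation.

(** * Lebesgue measurable sets *)

Section lebesgue_sets.
Context {R : realType}.
Implicit Types (A B : set R) (l : R -> R).

(** The image measure agrees with the Lebesgue measure on half-open
    intervals. *)
Lemma lebesgue_measure_reflection (t : R) A : measurable A ->
  lebesgue_measure ((fun s => t - s) @^-1` A) = lebesgue_measure A.
Proof.
have mf : measurable_fun [set: R] (fun s : R => t - s : measurableTypeR R).
  exact: measurable_funB.
move=> mA.
pose m := pushforward lebesgue_measure
  (fun s : measurableTypeR R => t - s : measurableTypeR R).
transitivity (m A) => //.
apply/esym/lebesgue_measure_unique => //= _ [[a b]] _ <-.
rewrite /m /pushforward.
rewrite [X in _ = lebesgue_measure X](_ : _ = `[t - b, t - a[%classic);
  last first.
  by apply/seteqP; split => s /=; rewrite !in_itv/=; lra.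
by rewrite !lebesgue_measure_itv/= !lte_fin; case: ifPn; case: ifPn => //= ? ?;
  rewrite -?EFinB; try congr EFin; lra.
Qed.

Local Notation leb := (@lebesgue_measure R).

(** Carathéodory measurability gives access to the countable additivity of the
    outer measure on completed sets. *)
Lemma completed_caratheodory A : completed_algebra_gen leb A ->
  ((wlength idfun)^*%mu).-cara.-measurable A.
Proof.
by rewrite -completed_caratheodory_measurable; exact: sub_sigma_algebra.
Qed.

Lemma measurable_completed A : measurable A -> completed_algebra_gen leb A.
Proof.
move=> mA; exists A => //; exists set0; first exact: negligible_set0.
by rewrite setU0.
Qed.

Lemma nondecreasing_cvg_completed (F : (set R)^nat) :
  (forall n, completed_algebra_gen leb (F n)) ->
  {homo F : n m / (n <= m)%N >-> (n <= m)%O} ->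
  (leb \o F) x @[x --> \oo] --> leb (\bigcup_n F n).
Proof.
move=> mF ndF; have cF n := completed_caratheodory (mF n).
apply: (@nondecreasing_cvg_mu _ _ _ (@completed_lebesgue_measure R)) => //.
exact: bigcupT_measurable.
Qed.

(** The integral is a supremum over simple functions, hence monotone even on
    nonmeasurable integrands; the set is then squeezed between two Borel sets of
    equal measure. *)
Lemma integral_indic_completed A :
  completed_algebra_gen leb A -> (\int[leb]_x (\1_A x)%:E = leb A)%E.
Proof.
move=> [X mX [N [N' [mN' N'0 NN']]] <-].
have XU : leb (X `|` N) = leb X.
  apply/le_anti/andP; split; last exact: lebesgue_measure_le (@subsetUl _ _ _).
  apply: le_trans (lebesgue_measureU2 _ _) _.
  rewrite -[leRHS]adde0 leeD2l// -N'0; exact: lebesgue_measure_le.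
have XU' : (leb (X `|` N') <= leb X)%E.
  apply: le_trans (lebesgue_measureU2 _ _) _.
  by rewrite [X in (_ + X)%E]N'0 adde0.
have sandwich B C : B `<=` C ->
    (\int[leb]_x (\1_B x)%:E <= \int[leb]_x (\1_C x)%:E)%E.
  move=> BC; rewrite !ge0_integralTE//; [|by move=> x; rewrite lee_fin..].
  apply: ereal_sup_le => _ [h hB <-]; exists h => // x.
  apply: le_trans (hB x) _; rewrite lee_fin !indicE ler_nat.
  by case: (boolP (x \in B)) => //; rewrite !inE => /BC /mem_set ->.
rewrite XU; apply/eqP; rewrite eq_le; apply/andP; split.
  apply: le_trans (sandwich _ (X `|` N') _) _; first exact: setUS.
  have mXN' : measurable (X `|` N' : set (measurableTypeR R)).
    exact: measurableU mX mN'.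
  by rewrite (integral_indic _ measurableT mXN') setIT; exact: XU'.
apply: le_trans (sandwich X _ _); last exact: subsetUl.
by rewrite (integral_indic _ measurableT mX) setIT.
Qed.

Lemma Rintegral_completed (D A : set R) (f : R -> R) :
  completed_algebra_gen leb A -> A `<=` D -> {in D, f =1 \1_A} ->
  (\int[leb]_(x in D) f x)%R = length_of A.
Proof.
move=> mA AD fA; rewrite /Rintegral /length_of integral_mkcond.
rewrite (_ : (_ \_ _) = fun x => (\1_A x)%:E) ?integral_indic_completed//.
apply/funext => x; rewrite patchE; case: ifPn => xD; first by rewrite fA.
rewrite indicE; case: (boolP (x \in A)) => //.
by rewrite inE => /AD /mem_set; rewrite (negbTE xD).
Qed.

End lebesgue_sets.

(** * Dependence of the source term on the space variable *)

Section source_set_measurable.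
Context {R : realType}.
Implicit Types (u l m : R -> R) (tau xi : R).
Local Notation leb := (@lebesgue_measure R).

Lemma measurable_source_set l tau xi :
  measurable_fun `[(0 : R), +oo[ l -> measurable (source_set l tau xi).
Proof.
move=> ml; have ml' : measurable_fun `]0, tau[ (fun s => l s + s).
  apply: measurable_funD => //; apply: measurable_funS ml => // s /=.
  by rewrite !in_itv/= andbT; lra.
rewrite (_ : source_set l tau xi =
    `]0, tau[ `&` (fun s => l s + s) @^-1` `]xi, +oo[); first exact: ml'.
by apply/seteqP; split => s /=; rewrite !in_itv/= andbT.
Qed.

Lemma source_time_reflection l t : measurable_fun `[(0 : R), +oo[ l ->
  length_of [set s | 0 <= s <= t /\ s < l (t - s)] = source_time l t t.
Proof.
move=> ml; rewrite length_of_itvcc_itvoo.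
rewrite (_ : [set s | _] = (fun s => t - s) @^-1` source_set l t t); last first.
  by apply/seteqP; split => s [/= st ls]; split => /=; lra.
rewrite /length_of lebesgue_measure_reflection//.
exact: measurable_source_set.
Qed.

(** The sets [source_set l tau xi] increase to [source_set l tau xi0] as [xi]
    decreases to [xi0]. The limit is taken along [xi0 + 1 / (n + 1)], and
    monotonicity in [xi] extends it to the whole right neighbourhood. *)
Lemma source_time_at_right l tau xi0 :
  (forall xi, xi0 < xi -> completed_algebra_gen leb (source_set l tau xi)) ->
  source_time l tau xi @[xi --> xi0^'+] --> source_time l tau xi0.
Proof.
move=> ml; pose F n := source_set l tau (xi0 + n.+1%:R^-1).
have inv0 n : 0 < n.+1%:R^-1 :> R by rewrite invr_gt0 ltr0n.
have FE : \bigcup_n F n = source_set l tau xi0.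
  apply/seteqP; split => [s [n _ [/= st ls]]|s [/= st ls]].
    by split => //; apply: le_lt_trans ls; rewrite lerDl ltW.
  have d0 : 0 < l s + s - xi0 by lra.
  have [n nd] : exists n, n.+1%:R^-1 < l s + s - xi0.
    have [N _ /(_ N (leqnn N))] := near_infty_natSinv_lt (PosNum d0).
    by exists N.
  by exists n => //; split => //=; rewrite addrC -ltrBrDr.
have ndF : {homo F : n m / (n <= m)%N >-> (n <= m)%O}.
  move=> n m nm; rewrite subsetEset => s [/= st ls]; split => //.
  apply: le_lt_trans ls; rewrite lerD2l.
  by rewrite lef_pV2 ?posrE ?ltr0n// ler_nat.
have cF : source_time l tau (xi0 + n.+1%:R^-1) @[n --> \oo] -->
    source_time l tau xi0.
  apply: fine_cvg; rewrite fineK; last first.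
    exact/lebesgue_measure_fin/source_set_sub.
  rewrite -FE; apply: nondecreasing_cvg_completed => // n.
  by apply: ml; rewrite ltrDl.
apply/cvgrPdist_lt => e e0; move/cvgrPdist_lt : cF => /(_ e e0) [N _ hN].
have := hN N (leqnn N); have x0 : xi0 <= xi0 + N.+1%:R^-1 by rewrite lerDl ltW.
rewrite ger0_norm ?subr_ge0 ?source_time_nonincreasing// => FN.
near=> xi; have lt0 : xi0 < xi by near: xi; exact: nbhs_right_gt.
have ltN : xi < xi0 + N.+1%:R^-1.
  by near: xi; apply: nbhs_right_lt; rewrite ltrDl.
have := source_time_nonincreasing l tau (ltW lt0).
have := source_time_nonincreasing l tau (ltW ltN).
by move=> h1 h2; rewrite ger0_norm; lra.
Unshelve. all: by end_near. Qed.

Lemma indicator_sourceE m tau xi : tau <= xi ->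
  {in `]0, tau[%classic,
    (fun s => \1_(`]s, m s + s[%classic) xi : R) =1 \1_(source_set m tau xi)}.
Proof.
move=> tx s; rewrite inE/= in_itv/= => st; rewrite !indicE.
congr (nat_of_bool _)%:R; apply/idP/idP; rewrite !inE /source_set /= in_itv/=.
  by move=> h; split => //; lra.
by move=> [_ h]; lra.
Qed.

End source_set_measurable.

(** * Traces, uniqueness and regularity *)

Section main_lemmas.
Context {R : realType}.
Implicit Types (u l m : R -> R) (tau xi : R).
Local Notation leb := (@lebesgue_measure R).

Lemma delay_solutionE u l t : delay_solution u l -> 0 <= t ->
  l t = u t + source_time l t t.
Proof.
move=> [bl _ eq] t0; rewrite eq// source_time_reflection//.
exact: BVloc_measurable.
Qed.

Lemma completed_source_set u l tau xi : delay_solution u l ->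
  completed_algebra_gen leb (source_set l tau xi).
Proof.
move=> [bl _ _]; apply: measurable_completed.
by apply: measurable_source_set; exact: BVloc_measurable.
Qed.

Lemma vsol_at_right u l tau : admissible_datum u -> delay_solution u l ->
  0 <= tau -> vsol u l tau xi @[xi --> tau^'+] --> l tau.
Proof.
move=> [_ ru _ _] hl t0; rewrite (delay_solutionE hl t0).
under eq_fun do rewrite vsolE.
apply: cvgD; first exact: ru.
by apply: source_time_at_right => xi _; exact: completed_source_set hl.
Qed.

Lemma trace_vsol u l tau : admissible_datum u -> delay_solution u l ->
  0 <= tau -> trace (vsol u l) tau = l tau.
Proof. by move=> au hl t0; apply: cvg_lim => //; exact: vsol_at_right. Qed.

Lemma integral_solution_source u w tau xi :
  integral_solution u w -> 0 < tau -> tau < xi ->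
  completed_algebra_gen leb (source_set (trace w) tau xi) /\
  w tau xi = u xi + source_time (trace w) tau xi.
Proof.
move=> [_ _ _ _ hw] t0 tx; have [/= mw ->] := hw tau xi t0 tx.
have sE := indicator_sourceE (trace w) (ltW tx).
have cS : completed_algebra_gen leb (source_set (trace w) tau xi).
  have := mw [set 1] (measurable_set1 1); congr (completed_algebra_gen _ _).
  apply/seteqP; split => s /=.
    move=> [st] /=; rewrite sE ?inE//= indicE.
    by case: (boolP (s \in _)) => [|_ /eqP]; rewrite ?inE// eq_sym oner_eq0.
  move=> ss; have st := source_set_sub ss; split => //=.
  by rewrite sE ?inE//= indicE mem_set.
split => //; congr (_ + _); apply: Rintegral_completed => //.
exact: source_set_sub.
Qed.

(** Letting [xi] decrease to [tau] in the integral formula closes the equation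
    on the trace alone. *)
Lemma trace_integral_solution u w tau : admissible_datum u ->
  integral_solution u w -> 0 < tau ->
  trace w tau = u tau + source_time (trace w) tau tau.
Proof.
move=> [_ ru _ _] hw t0; apply: cvg_lim => //.
have := ru tau (ltW t0).
move=> /cvgD /(_ (@source_time_at_right _ (trace w) tau tau _)).
move=> /(_ (fun xi tx => (integral_solution_source hw t0 tx).1)).
apply: cvg_trans; apply: near_eq_cvg; near=> xi.
have tx : tau < xi by near: xi; exact: nbhs_right_gt.
by rewrite (integral_solution_source hw t0 tx).2.
Unshelve. all: by end_near. Qed.

Lemma integral_solution_unique u l w : admissible_datum u ->
  delay_solution u l -> integral_solution u w ->
  forall tau xi, 0 < tau -> tau < xi -> w tau xi = vsol u l tau xi.
Proof.
move=> au hl hw tau xi t0 tx.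
rewrite vsolE (integral_solution_source hw t0 tx).2.
have [_ _ u0 [alpha a0 ua]] := au.
have wl t : 0 < t -> trace w t = l t.
  apply: (delay_unique a0 (fun t t0 => u0 t (ltW t0))) => {t}t.
  - by move=> ?; apply: ua; lra.
  - exact: trace_integral_solution.
  - by move=> t0'; apply: delay_solutionE hl (ltW t0').
congr (_ + _); apply/le_anti/andP; split; apply: source_time_le => s st;
  by rewrite wl//; lra.
Qed.

Lemma vsol_le u1 u2 l1 l2 : admissible_datum u2 ->
  delay_solution u1 l1 -> delay_solution u2 l2 ->
  (forall x, 0 <= x -> u1 x <= u2 x) ->
  forall tau xi, 0 <= tau -> tau <= xi ->
    vsol u1 l1 tau xi <= vsol u2 l2 tau xi.
Proof.
move=> [_ _ u0 [alpha a0 ua]] hl1 hl2 u12 tau xi t0 tx; rewrite !vsolE.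
have eq1 t : 0 < t -> l1 t = u1 t + source_time l1 t t.
  by move=> ?; apply: delay_solutionE hl1 _; lra.
have eq2 t : 0 < t -> l2 t = u2 t + source_time l2 t t.
  by move=> ?; apply: delay_solutionE hl2 _; lra.
have l2a : forall t, 0 < t -> alpha <= l2 t.
  apply: (delay_ge a0 _ _ eq2) => t ?; last by apply: ua; lra.
  by apply: u0; lra.
apply: lerD; first by apply: u12; lra.
apply: source_time_le => s st.
have : l1 s <= l2 s; last lra.
apply: (delay_comparison a0 l2a _ eq1 eq2); last by lra.
by move=> t ?; apply: u12; lra.
Qed.

Lemma vsol_lipschitz u l xi : 1.-lipschitz_(`[0, xi]) (vsol u l ^~ xi).
Proof.
suff P t1 t2 : 0 <= t1 -> t1 <= t2 ->
    `|vsol u l t1 xi - vsol u l t2 xi| <= `|t1 - t2|.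
  move=> [t1 t2] [/= h1 h2]; rewrite mul1r; rewrite !in_itv/= in h1 h2.
  have [t12|t21] := leP t1 t2; first by apply: P; lra.
  by rewrite distrC [leRHS]distrC; apply: P; lra.
move=> t10 t12; rewrite !vsolE opprD addrACA subrr add0r.
rewrite distrC [leRHS]distrC [leRHS]ger0_norm ?subr_ge0//.
rewrite ger0_norm ?subr_ge0; last exact: source_time_nondecreasing.
by have := source_time_le_add l xi t10 t12; lra.
Qed.

Lemma vsol_BVloc u l tau : BVloc 0 u -> 0 <= tau -> BVloc tau (vsol u l tau).
Proof.
move=> bu t0 b tb.
rewrite (_ : vsol u l tau = u \+ (\- (\- source_time l tau))); last first.
  by apply/funext => x; rewrite /= vsolE opprK.
apply: bounded_variationD => //.
  by apply: (@bounded_variationr _ 0) => //; [lra|apply: bu; lra].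
apply: bounded_variationN; apply: nondecreasing_bounded_variation.
by move=> x y _ _ xy; rewrite lerN2 source_time_nonincreasing.
Qed.

End main_lemmas.

(** * The explicit function is an integral solution *)

Section existence.
Context {R : realType}.
Implicit Types (u l m : R -> R) (tau xi : R).
Local Notation leb := (@lebesgue_measure R).

Lemma measurable_ltr_set d (T : measurableType d) (f g : T -> R) :
  measurable_fun [set: T] f -> measurable_fun [set: T] g ->
  measurable [set x | f x < g x].
Proof.
move=> mf mg; rewrite -[X in measurable X]setTI.
exact: (measurable_fun_ltr mf mg measurableT (Y := [set true])).
Qed.

(** The source time is the measure of the section at [(tau, xi)] of a Borel set
    of triples [(tau, xi, s)]. *)
Lemma measurable_source_time l : measurable_fun `[(0 : R), +oo[ l ->
  measurable_fun [set: R * R] (fun p => source_time l p.1 p.2).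
Proof.
move=> ml; pose l0 := l \_ `[0, +oo[.
have ml0 : measurable_fun [set: R] l0.
  by apply/(measurable_restrictT _ (measurable_itv _)).
pose A : set ((R * R) * R) :=
  [set z | 0 < z.2] `&`
    ([set z | z.2 < z.1.1] `&` [set z | z.1.2 < l0 z.2 + z.2]).
have mA : measurable A.
  apply: measurableI; first by apply: measurable_ltr_set.
  apply: measurableI; apply: measurable_ltr_set.
  - exact: measurable_snd.
  - exact: (measurableT_comp measurable_fst measurable_fst).
  - exact: (measurableT_comp measurable_snd measurable_fst).
  - apply: measurable_funD; last exact: measurable_snd.
    exact: (measurableT_comp ml0 measurable_snd).
rewrite (_ : (fun p => _) = fine \o (leb \o xsection A)).
  apply: measurableT_comp => //; exact: measurable_fun_xsection.
apply/funext => p /=; congr (fine (leb _)).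
apply/seteqP; split => s; rewrite /source_set /xsection /= inE /A /= /l0.
  move=> [st ls]; rewrite patchE mem_set; last by rewrite /= in_itv/=; lra.
  by split; [|split]; lra.
move=> [s0 [st]]; rewrite patchE mem_set; last by rewrite /= in_itv/=; lra.
by split => //; lra.
Qed.

Lemma measurable_open_domain : measurable (@open_domain R).
Proof.
rewrite (_ : @open_domain R = [set p | 0 < p.1] `&` [set p | p.1 < p.2]) //.
by apply: measurableI; apply: measurable_ltr_set.
Qed.

Lemma vsol_measurable u l : admissible_datum u -> delay_solution u l ->
  completed_measurable_fun (leb \x leb)%E
    (@open_domain R) (fun p => vsol u l p.1 p.2).
Proof.
move=> [bu _ _ _] [bl _ _] Y mY.
exists (@open_domain R `&` (fun p => vsol u l p.1 p.2) @^-1` Y); last first.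
  by exists set0; [exact: negligible_set0|rewrite setU0].
pose u1 := u \_ `[0, +oo[.
have mu1 : measurable_fun [set: R] u1.
  by apply/(measurable_restrictT _ (measurable_itv _)); exact: BVloc_measurable.
suff m : measurable_fun (@open_domain R) (fun p => vsol u l p.1 p.2).
  by apply: m => //; exact: measurable_open_domain.
apply: (eq_measurable_fun (fun p => u1 p.2 + source_time l p.1 p.2)).
  move=> p; rewrite inE => -[/= p0 p12]; rewrite vsolE /u1 patchE mem_set//=.
  by rewrite in_itv/=; lra.
apply: measurable_funTS; apply: measurable_funD; first exact: measurableT_comp.
by apply: measurable_source_time; exact: BVloc_measurable.
Qed.

Lemma vsol_locally_bounded u l : admissible_datum u ->
  [locally [bounded vsol u l p.1 p.2 | p in @open_domain R]].
Proof.
move=> [bu _ _ _] p [/= p0 p12].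
have [M M0 hM] := BVloc_bounded (p.2 + 1) bu.
rewrite /bounded_near; near=> K; rewrite /within /=.
exists (`]-oo, p.1 + 1[%classic, `]-oo, p.2 + 1[%classic).
  by split; apply: open_nbhs_nbhs; split;
    rewrite /= ?in_itv/= ?ltrDl//; exact: lray_open.
move=> q [/=]; rewrite !in_itv/= => q1 q2 [/= q0 q12].
apply: (@le_trans _ _ (M + (p.1 + 1))); last first.
  by near: K; apply: nbhs_pinfty_ge; exact: num_real.
rewrite vsolE; apply: le_trans (ler_normD _ _) _.
rewrite lerD//; first by apply: hM; lra.
rewrite ger0_norm ?source_time_ge0//.
by apply: le_trans (source_time_le_tau _ _ (ltW q0)) _; lra.
Unshelve. all: by end_near. Qed.

Lemma eq_source_set l m tau xi : (forall s, 0 < s < tau -> l s = m s) ->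
  source_set l tau xi = source_set m tau xi.
Proof.
by move=> lm; apply/seteqP; split => s [/= st]; [rewrite lm|rewrite -lm].
Qed.

Lemma vsol_integral_solution u l : admissible_datum u -> delay_solution u l ->
  integral_solution u (vsol u l).
Proof.
move=> au hl; have [bu ru u0 _] := au; have [bl l0 _] := hl.
split.
- exact: vsol_measurable.
- exact: vsol_locally_bounded.
- move=> tau xi t0 tx.
  by rewrite vsolE addr_ge0 ?source_time_ge0//; apply: u0; lra.
- move=> tau t0; rewrite trace_vsol ?l0//; [|exact: ltW..].
  split => //; apply/cvg_ex; exists (l tau).
  exact: (vsol_at_right au hl (ltW t0)).
move=> tau xi t0 tx integrand.
have mS : completed_algebra_gen leb (source_set l tau xi).
  exact: completed_source_set hl.
have sE : {in `]0, tau[%classic, integrand =1 \1_(source_set l tau xi)}.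
  move=> s sI; rewrite /integrand.
  have /= -> := indicator_sourceE (trace (vsol u l)) (ltW tx) sI.
  rewrite (@eq_source_set _ l)// => r /andP[r0 _].
  by rewrite trace_vsol// ltW.
split; last first.
  rewrite vsolE (Rintegral_completed mS)//; exact: source_set_sub.
move=> Y mY; apply: measurable_completed.
suff m : measurable_fun `]0, tau[ integrand by apply: m.
apply: (eq_measurable_fun (\1_(source_set l tau xi) : R -> R)).
  by move=> s sI; rewrite sE.
apply: measurable_indic; apply: measurable_source_set.
exact: BVloc_measurable.
Qed.

Lemma vsol_slope_le u l (C : R) :
  (forall xi h : R, 0 <= xi -> 0 < h -> (u (xi + h) - u xi) / h <= C) ->
  forall tau xi h : R, 0 <= xi -> 0 < h ->
    (vsol u l tau (xi + h) - vsol u l tau xi) / h <= C.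
Proof.
move=> uC tau xi h x0 h0; apply: le_trans (uC xi h x0 h0).
rewrite ler_pM2r ?invr_gt0// !vsolE.
have := @source_time_nonincreasing _ l tau xi (xi + h); rewrite lerDl ltW//.
by move=> /(_ isT); lra.
Qed.

End existence.

(** * Conservation of mass *)

Section mass.
Context {R : realType}.
Implicit Types (u l : R -> R) (tau xi : R).
Local Notation leb := (@lebesgue_measure R).

Lemma source_time_EFin l tau xi :
  leb (source_set l tau xi) = (source_time l tau xi)%:E.
Proof.
rewrite /source_time /length_of fineK//.
exact/lebesgue_measure_fin/source_set_sub.
Qed.

(** Both sides are the area of the set of [(s, xi)] with [0 < s < tau] and
    [s < xi < l s + s]. Its section at [xi] is [source_set l xi xi] when
    [xi <= tau], because of the constraint [s < xi], and [source_set l tau xi]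
    beyond. *)
Lemma tonelli_source l tau : measurable_fun `[(0 : R), +oo[ l ->
  (forall s, 0 <= s -> 0 <= l s) -> 0 <= tau ->
  (\int[leb]_(s in `]0%R, tau]) (l s)%:E =
   \int[leb]_(xi in `]0%R, tau]) (source_time l xi xi)%:E +
   \int[leb]_(xi in `]tau, +oo[) (source_time l tau xi)%:E)%E.
Proof.
move=> ml l0 t0; pose k := l \_ `[0, +oo[.
have mk : measurable_fun [set: R] k.
  by apply/(measurable_restrictT _ (measurable_itv _)).
pose B : set (R * R) := [set z | 0 < z.1] `&` [set z | z.1 < tau] `&`
  ([set z | z.1 < z.2] `&` [set z | z.2 < k z.1 + z.1]).
have mB : measurable B.
  apply: measurableI; apply: measurableI; apply: measurable_ltr_set => //.
  by apply: measurable_funD => //; exact: (measurableT_comp mk measurable_fst).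
have kE s : 0 <= s -> k s = l s.
  by move=> s0; rewrite /k patchE mem_set//= in_itv/= s0.
have FE : leb \o xsection B = (EFin \o l) \_ `]0, tau[.
  apply/funext => s /=; rewrite patchE; case: ifPn => sI.
    have /andP[s0 st] : 0 < s < tau by move: sI; rewrite inE/= in_itv.
    rewrite (_ : xsection B s = `]s, s + l s[%classic).
      by rewrite lebesgue_measure_itvoo ?lerDl ?l0 ?ltW//= addrAC subrr add0r.
    apply/seteqP; split => y; rewrite /xsection /= inE /B /= in_itv/= kE ?ltW//;
      lra.
  rewrite (_ : xsection B s = set0) ?measure0//.
  apply/seteqP; split => y //; rewrite /xsection /= inE => -[[s0 st] _].
  by move/negP: sI; rewrite inE/= in_itv/= s0.
have GE : leb \o ysection B =
    (fun xi => (source_time l (Num.min xi tau) xi)%:E) \_ `]0, +oo[.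
  apply/funext => y /=; rewrite patchE; case: ifPn => yI; last first.
    rewrite (_ : ysection B y = set0) ?measure0//.
    apply/seteqP; split => s //; rewrite /ysection /= inE.
    move=> -[[/= s0 st] [/= sy _]].
    by move/negP: yI; rewrite inE/= in_itv/= (lt_trans s0).
  rewrite -source_time_EFin; congr (leb _).
  apply/seteqP; split => s; rewrite /ysection /source_set /= inE /B /= lt_min.
    by move=> [[s0 ->] [-> ys]]; rewrite s0; split => //; rewrite -kE ?ltW.
  by move=> [/and3P[s0 -> ->]]; rewrite kE ?ltW.
have mG : measurable_fun `](0 : R), +oo[
    (fun xi => (source_time l (Num.min xi tau) xi)%:E).
  apply/(measurable_restrictT _ (measurable_itv _)); rewrite -GE.
  exact: measurable_fun_ysection.
have := indic_fubini_tonelli leb leb mB.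
rewrite indic_fubini_tonelli_FE// indic_fubini_tonelli_GE// FE GE.
rewrite -!integral_mkcond => FG.
transitivity (\int[leb]_(s in `]0%R, tau[) (l s)%:E)%E.
  apply/esym/integral_itv_bndo_bndc; apply/measurable_EFinP.
  by apply: measurable_funS ml => // s; rewrite /= !in_itv/=; lra.
rewrite [LHS]FG (@itv_bndbnd_setU _ _ _ (BRight tau)) ?bnd_simp//.
rewrite ge0_integral_setU//=.
- congr (_ + _)%E; apply: eq_integral => y; rewrite inE/= in_itv/=.
    by move=> /andP[_ yt]; rewrite (min_idPl yt).
  by rewrite andbT => /ltW ty; rewrite (min_idPr ty).
- by rewrite -itv_bndbnd_setU ?bnd_simp.
- by move=> y _; rewrite lee_fin source_time_ge0.
- apply/disj_setPS => y [/=]; rewrite !in_itv/= andbT => /andP[_ yt].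
  by rewrite ltNge yt.
Qed.

(** Substituting the delay equation in the left-hand side of Tonelli's identity,
    the finite integral of [source_time l s s] cancels and leaves
    [int_tau^oo source_time l tau = int_0^tau u], which completes the integral
    of [u] over [(tau, +oo)]. *)
Lemma vsol_mass u l tau :
  admissible_datum u -> delay_solution u l -> 0 <= tau ->
  measurable_fun `]tau, +oo[ (vsol u l tau) /\
  (\int[leb]_(xi in `]tau, +oo[) (vsol u l tau xi)%:E =
   \int[leb]_(xi in `]0%R, +oo[) (u xi)%:E)%E.
Proof.
move=> [bu _ u0 _] hl t0; have [bl l0 _] := hl.
have mu := BVloc_measurable bu; have ml := BVloc_measurable bl.
have mu1 : measurable_fun `](0 : R), tau] u.
  by apply: measurable_funS mu => // s; rewrite /= !in_itv/=; lra.
have mu2 : measurable_fun `](0 : R), +oo[ u.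
  by apply: measurable_funS mu => // s; rewrite /= !in_itv/= !andbT; lra.
have mu3 : measurable_fun `]tau, +oo[ u.
  by apply: measurable_funS mu => // s; rewrite /= !in_itv/= !andbT; lra.
have mst : measurable_fun `]tau, +oo[ (source_time l tau).
  apply: nonincreasing_measurable => // x y.
  exact: source_time_nonincreasing.
have mdiag : measurable_fun `](0 : R), tau] (fun x => source_time l x x).
  apply: (eq_measurable_fun (l \- u)).
    move=> x; rewrite inE/= in_itv/= => /andP[x0 _].
    by rewrite (delay_solutionE hl (ltW x0)) addrAC subrr add0r.
  apply: measurable_funB => //.
  by apply: measurable_funS ml => // s; rewrite /= !in_itv/=; lra.
have vE : vsol u l tau = u \+ source_time l tau.
  by apply/funext => x; rewrite vsolE.
split; first by rewrite vE; exact: measurable_funD.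
have u_ge0 x : 0 <= x -> (0 <= (u x)%:E)%E by move=> ?; rewrite lee_fin u0.
have cancel : (\int[leb]_(xi in `]0%R, tau]) (u xi)%:E =
    \int[leb]_(xi in `]tau, +oo[) (source_time l tau xi)%:E)%E.
  have := tonelli_source ml l0 t0.
  have -> : (\int[leb]_(s in `]0%R, tau]) (l s)%:E =
      \int[leb]_(s in `]0%R, tau]) ((u s)%:E + (source_time l s s)%:E))%E.
    apply: eq_integral => x; rewrite inE/= in_itv/= => /andP[x0 _].
    by rewrite (delay_solutionE hl (ltW x0)).
  rewrite ge0_integralD//=; first last.
  - exact/measurable_EFinP.
  - by move=> x _; rewrite lee_fin source_time_ge0.
  - exact/measurable_EFinP.
  - by move=> x; rewrite /= in_itv/= => /andP[/ltW x0 _]; exact: u_ge0.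
  set D := (\int[leb]_(s in `]0%R, tau]) (source_time l s s)%:E)%E.
  have Dfin : D \is a fin_num.
    rewrite ge0_fin_numE ?integral_ge0//; last first.
      by move=> x _; rewrite lee_fin source_time_ge0.
    apply: (@le_lt_trans _ _ (\int[leb]_(s in `]0%R, tau]) (cst tau%:E) s)%E).
      apply: ge0_le_integral => //.
      - by move=> x _; rewrite lee_fin source_time_ge0.
      - exact/measurable_EFinP.
      - move=> x; rewrite /= in_itv/= => /andP[x0 xt]; rewrite lee_fin.
        exact: le_trans (source_time_le_tau _ _ (ltW x0)) xt.
    rewrite integral_cst//= lebesgue_measure_itv/=.
    by case: ifP => _; rewrite ?mule0 ?ltry// -EFinB -EFinM ltry.
  by move=> UD; rewrite -[LHS](addeK _ Dfin) UD addeAC subee// add0e.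
rewrite [in RHS](@itv_bndbnd_setU _ _ _ (BRight tau)) ?bnd_simp//.
rewrite ge0_integral_setU//=; first last.
- apply/disj_setPS => y [/=]; rewrite !in_itv/= andbT => /andP[_ yt].
  by rewrite ltNge yt.
- by move=> y [|] /=; rewrite !in_itv/= ?andbT => ty; apply: u_ge0; lra.
- by rewrite -itv_bndbnd_setU ?bnd_simp//; exact/measurable_EFinP.
rewrite cancel addeC vE -ge0_integralD//.
- move=> y; rewrite /= in_itv/= andbT => ty; apply: u_ge0; lra.
- exact/measurable_EFinP.
- by move=> x _; rewrite lee_fin source_time_ge0.
- exact/measurable_EFinP.
Qed.

Lemma vsol_integrable u l tau : admissible_datum u -> delay_solution u l ->
  0 <= tau -> leb.-integrable `]0, +oo[ (EFin \o u) ->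
  leb.-integrable `]tau, +oo[ (EFin \o vsol u l tau).
Proof.
move=> au hl t0 /integrableP[_ iu]; have [mv iv] := vsol_mass au hl t0.
have [_ _ u0 _] := au.
apply/integrableP; split; first exact/measurable_EFinP.
move: iu; congr (_ < _)%E.
transitivity (\int[leb]_(xi in `]0%R, +oo[) (u xi)%:E)%E.
  apply: eq_integral => x; rewrite inE/= in_itv/= andbT => x0.
  by rewrite ger0_norm// u0// ltW.
rewrite -iv; apply: eq_integral => x; rewrite inE/= in_itv/= andbT => tx.
by rewrite ger0_norm// vsolE addr_ge0 ?source_time_ge0// u0//; lra.
Qed.

End mass.

Theorem theorem5p1 (R : realType) (u0 l : R -> R)
    (hu0 : admissible_datum u0) (hl : delay_solution u0 l) :
  let v := vsol u0 l in
  (integral_solution u0 v /\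
   (forall w : R -> R -> R, integral_solution u0 w ->
      forall tau xi : R, 0 < tau -> tau < xi -> w tau xi = v tau xi)) /\
  ((forall tau : R, 0 <= tau -> v tau tau = l tau) /\
   (forall tau : R, 0 < tau -> trace v tau = v tau tau)) /\
  (* (i) *)
  (forall xi : R, 0 <= xi -> 1.-lipschitz_(`[0, xi]) (fun tau => v tau xi)) /\
  (* (ii) *)
  (forall tau : R, 0 < tau -> BVloc tau (v tau)) /\
  (* (iii) *)
  (forall u1 u2 l1 l2 : R -> R,
     admissible_datum u1 -> admissible_datum u2 ->
     delay_solution u1 l1 -> delay_solution u2 l2 ->
     (forall x : R, 0 <= x -> u1 x <= u2 x) ->
     forall tau xi : R, 0 <= tau -> tau <= xi ->
       vsol u1 l1 tau xi <= vsol u2 l2 tau xi) /\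
  (* (iv) *)
  (forall C : R, 0 < C ->
     (forall xi h : R, 0 <= xi -> 0 < h -> (u0 (xi + h) - u0 xi) / h <= C) ->
     forall tau xi h : R, 0 <= tau -> tau <= xi -> 0 < h ->
       (v tau (xi + h) - v tau xi) / h <= C) /\
  (* (v) *)
  (lebesgue_measure.-integrable `]0, +oo[ (EFin \o u0) ->
   [bounded u0 x | x in `[0, +oo[] ->
   forall tau : R, 0 <= tau ->
     lebesgue_measure.-integrable `]tau, +oo[ (EFin \o v tau) /\
     (\int[lebesgue_measure]_(xi in `]tau, +oo[) v tau xi =
      \int[lebesgue_measure]_(xi in `]0, +oo[) u0 xi)%R).
Proof.
have diag tau : 0 <= tau -> vsol u0 l tau tau = l tau.
  by move=> t0; rewrite vsolE -(delay_solutionE hl t0).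
move=> v; split; [split|split; [split|split; [|split; [|split; [|split]]]]].
- exact: vsol_integral_solution.
- by move=> w; exact: integral_solution_unique.
- exact: diag.
- by move=> tau t0; rewrite /v (trace_vsol hu0 hl (ltW t0)) (diag _ (ltW t0)).
- by move=> xi _; exact: (vsol_lipschitz u0 l).
- by move=> tau t0; have [bu _ _ _] := hu0; apply: vsol_BVloc bu (ltW t0).
- by move=> u1 u2 l1 l2 _; exact: vsol_le.
- move=> C _ uC tau xi h t0 tx h0.
  by apply: vsol_slope_le => //; exact: le_trans tx.
move=> iu _ tau t0; split; first exact: vsol_integrable.
by rewrite /Rintegral (vsol_mass hu0 hl t0).2.
Qed.
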